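(* Let $\mathbb{F}$ be a field of characteristic not two, $\eta\in\mathbb{F}\setminus\{1,\frac12\}$, and let $A$ be a primitive $\mathcal{PC}(\eta)$-axial algebra over $\mathbb{F}$. Then $A$ admits a unique Frobenius form $(\cdot,\cdot)$ such that $(a,a)=1$ for all primitive axes $a\in A$.
   Context: Algebras are not assumed associative or unital. For a commutative $\mathbb{F}$-algebra $A$, $a\in A$ and $\lambda\in\mathbb{F}$, put $A_\lambda(a)=\{u\in A\mid au=\lambda u\}$. A ($\mathcal{PC}(\eta)$-)axis in $A$ is an idempotent $a\in A$ such that $A=A_1(a)\oplus A_\eta(a)\oplus A_{1/2}(a)$ and the fusion law $\mathcal{PC}(\eta)$ holds: $A_1(a)A_1(a)\subseteq A_1(a)$, $A_1(a)A_\eta(a)\subseteq A_\eta(a)$, $A_1(a)A_{1/2}(a)\subseteq A_{1/2}(a)$, $A_\eta(a)A_\eta(a)\subseteq A_1(a)$, $A_\eta(a)A_{1/2}(a)\subseteq A_{1/2}(a)$, $A_{1/2}(a)A_{1/2}(a)\subseteq A_1(a)\oplus A_\eta(a)$. An axis $a$ is primitive if $A_1(a)=\langle a\rangle$ is $1$-dimensional. A $\mathcal{PC}(\eta)$-axial algebra is a commutative $\mathbb{F}$-algebra generated by a set of axes; it is primitive if it is generated by a (non-empty) set of primitive axes. A Frobenius form on $A$ is a non-zero symmetric bilinear form $(\cdot,\cdot):A\times A\to\mathbb{F}$ with $(xy,z)=(x,yz)$ for all $x,y,z\in A$. *)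

(* Defs.v *)
From HB Require Import structures.
From mathcomp Require Import all_boot all_order all_algebra.
From mathcomp Require Import boolp classical_sets.

Set Implicit Arguments.
Unset Strict Implicit.
Unset Printing Implicit Defensive.

Import GRing.Theory.
Local Open Scope classical_set_scope.
Local Open Scope ring_scope.

(* A (not necessarily associative or unital, possibly infinite-dimensional)
   F-algebra is an F-module A together with a bilinear product
   mul : {bilinear A -> A -> A}. *)

Definition is_subalgebra (F : fieldType) (A : lmodType F)
    (mul : {bilinear A -> A -> A}) (B : set A) : Prop :=
  [/\ B 0,
      forall x y, B x -> B y -> B (x + y),
      forall (c : F) x, B x -> B (c *: x)
    & forall x y, B x -> B y -> B (mul x y)].

Definition generates (F : fieldType) (A : lmodType F)
    (mul : {bilinear A -> A -> A}) (X : set A) : Prop :=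
  smallest (is_subalgebra mul) X = setT.

Definition eigen (F : fieldType) (A : lmodType F)
    (mul : {bilinear A -> A -> A}) (a : A) (l : F) : set A :=
  [set u | mul a u = l *: u].

Definition set_mul (F : fieldType) (A : lmodType F)
    (mul : {bilinear A -> A -> A}) (U V : set A) : set A :=
  [set mul u v | u in U & v in V].

Definition set_sum (F : fieldType) (A : lmodType F) (U V : set A) : set A :=
  [set u + v | u in U & v in V].

(* A is the internal direct sum of U, V and W. *)
Definition direct_sum3 (F : fieldType) (A : lmodType F) (U V W : set A) : Prop :=
  forall x : A, exists! d : A * A * A,
    [/\ U d.1.1, V d.1.2, W d.2 & x = d.1.1 + d.1.2 + d.2].

Record PC_fusion (F : fieldType) (A : lmodType F)
    (mul : {bilinear A -> A -> A}) (eta : F) (a : A) : Prop := {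
  fusion_1_1 :
    set_mul mul (eigen mul a 1) (eigen mul a 1) `<=` eigen mul a 1;
  fusion_1_eta :
    set_mul mul (eigen mul a 1) (eigen mul a eta) `<=` eigen mul a eta;
  fusion_1_half :
    set_mul mul (eigen mul a 1) (eigen mul a 2^-1) `<=` eigen mul a 2^-1;
  fusion_eta_eta :
    set_mul mul (eigen mul a eta) (eigen mul a eta) `<=` eigen mul a 1;
  fusion_eta_half :
    set_mul mul (eigen mul a eta) (eigen mul a 2^-1) `<=` eigen mul a 2^-1;
  fusion_half_half :
    set_mul mul (eigen mul a 2^-1) (eigen mul a 2^-1)
      `<=` set_sum (eigen mul a 1) (eigen mul a eta)
}.

Definition is_axis (F : fieldType) (A : lmodType F)
    (mul : {bilinear A -> A -> A}) (eta : F) (a : A) : Prop :=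
  [/\ mul a a = a,
      direct_sum3 (eigen mul a 1) (eigen mul a eta) (eigen mul a 2^-1)
    & PC_fusion mul eta a].

(* The condition a != 0 says that the line spanned by a is 1-dimensional; it is
   not automatic, since 0 can satisfy is_axis. *)
Definition is_primitive_axis (F : fieldType) (A : lmodType F)
    (mul : {bilinear A -> A -> A}) (eta : F) (a : A) : Prop :=
  [/\ is_axis mul eta a,
      a != 0
    & eigen mul a 1 = [set c *: a | c in [set: F]]].

Definition primitive_PC_axial (F : fieldType) (A : lmodType F)
    (mul : {bilinear A -> A -> A}) (eta : F) : Prop :=
  commutative mul /\
  exists X : set A,
    [/\ X !=set0, X `<=` is_primitive_axis mul eta & generates mul X].

Definition is_Frobenius_form (F : fieldType) (A : lmodType F)
    (mul : {bilinear A -> A -> A}) (f : {biscalar A}) : Prop :=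
  [/\ exists x y, f x y != 0,
      forall x y, f x y = f y x
    & forall x y z, f (mul x y) z = f x (mul y z)].

Definition normalized_Frobenius_form (F : fieldType) (A : lmodType F)
    (mul : {bilinear A -> A -> A}) (eta : F) (f : {biscalar A}) : Prop :=
  is_Frobenius_form mul f /\
  forall a : A, is_primitive_axis mul eta a -> f a a = 1.

(* Main.v *)
(* Write [x = c a + s + u] along the decomposition of a primitive axis [a], and
   [c = axial_coef a x].  A Frobenius form with [(a, a) = 1] must satisfy
   [(a, x) = axial_coef a x], and the primitive axes span the algebra, which
   gives uniqueness.  For existence, the point is the symmetry
   [axial_coef a b = axial_coef b a]; it makes the linear extension of
   [(a, x) = axial_coef a x] to the span of the axes independent of the chosen
   linear combination.  The form so obtained is invariant under the Miyamoto
   involutions, so the eigenspaces of an axis are orthogonal to one another, and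
   the form is associative. *)

Require Import Defs.
From HB Require Import structures.
From mathcomp Require Import all_boot all_order all_algebra.
From mathcomp Require Import boolp classical_sets.
From mathcomp Require Import ring.

Set Implicit Arguments.
Unset Strict Implicit.
Unset Printing Implicit Defensive.

Import GRing.Theory.
Local Open Scope ring_scope.

Section PrimitiveAxes.

Variables (F : fieldType) (eta : F) (A : lmodType F).
Variable mul : {bilinear A -> A -> A}.
Hypothesis charF : 2%N \notin [pchar F].
Hypothesis eta_neq1 : eta != 1.
Hypothesis mulC : commutative mul.

Local Notation prim := (is_primitive_axis mul eta).
Implicit Types (a b x y s u : A) (c k : F).

(** * Linear rules for the product *)

Lemma two_neq0 : 2 != 0 :> F.
Proof. by move: charF; rewrite inE /=. Qed.

Lemma scale2_half x : 2^-1 *: x + 2^-1 *: x = x.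
Proof. by rewrite -scalerDl -mulr2n -[_ *+ 2]mulr_natl divff ?two_neq0 ?scale1r. Qed.

Lemma mulDl x y z : mul (x + y) z = mul x z + mul y z.
Proof. exact: linearDl. Qed.

Lemma mulDr x y z : mul x (y + z) = mul x y + mul x z.
Proof. exact: linearDr. Qed.

Lemma mulZl c x y : mul (c *: x) y = c *: mul x y.
Proof. exact: linearZl_LR. Qed.

Lemma mulZr c x y : mul x (c *: y) = c *: mul x y.
Proof. exact: linearZr_LR. Qed.

Lemma mulNl x y : mul (- x) y = - mul x y.
Proof. exact: linearNl. Qed.

Lemma mulNr x y : mul x (- y) = - mul x y.
Proof. exact: linearNr. Qed.

Lemma lin3D (v1 v2 v3 : A) c1 c2 c3 k1 k2 k3 :
  (c1 *: v1 + c2 *: v2 + c3 *: v3) + (k1 *: v1 + k2 *: v2 + k3 *: v3) =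
  (c1 + k1) *: v1 + (c2 + k2) *: v2 + (c3 + k3) *: v3.
Proof. by rewrite !scalerDl addrACA; congr (_ + _); rewrite addrACA. Qed.

Lemma lin3Z (v1 v2 v3 : A) k c1 c2 c3 :
  k *: (c1 *: v1 + c2 *: v2 + c3 *: v3) =
  (k * c1) *: v1 + (k * c2) *: v2 + (k * c3) *: v3.
Proof. by rewrite !scalerDr !scalerA. Qed.

(** * Eigenspace decomposition along a primitive axis *)

(* [parts a x = (c, s, u)] for [x = c a + s + u]; the value is junk unless [a] is a
   primitive axis. *)
Definition parts a x : F * A * A :=
  xget (0, 0, 0) [set d : F * A * A | [/\ mul a d.1.2 = eta *: d.1.2,
    mul a d.2 = 2^-1 *: d.2 & x = d.1.1 *: a + d.1.2 + d.2]]%classic.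

Definition axial_coef a x := (parts a x).1.1.
Definition eta_part a x := (parts a x).1.2.
Definition half_part a x := (parts a x).2.

Variant parts_spec a x : Prop :=
  PartsSpec of mul a (eta_part a x) = eta *: eta_part a x
    & mul a (half_part a x) = 2^-1 *: half_part a x
    & x = axial_coef a x *: a + eta_part a x + half_part a x.

Lemma prim_idem a : prim a -> mul a a = a.
Proof. by case=> -[]. Qed.

Lemma partsP a x : prim a -> parts_spec a x.
Proof.
move=> [[_ dec _] a_neq0 eig1].
have [[[v s] u] [[/= v1 seta uhalf xE] _]] := dec x.
have [c _ cE] : [set c *: a | c in [set: F]]%classic v by rewrite -eig1.
have := @xgetI _ (0, 0, 0) [set d : F * A * A | [/\ mul a d.1.2 = eta *: d.1.2,
    mul a d.2 = 2^-1 *: d.2 & x = d.1.1 *: a + d.1.2 + d.2]]%classic (c, s, u).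
by rewrite -/(parts a x) /= cE => -[].
Qed.

(** Directness of the sum fixes the three components; the scalar in front of [a] can then be read
    off because [a] is nonzero. *)
Lemma parts_unique a c s u : prim a -> mul a s = eta *: s ->
  mul a u = 2^-1 *: u -> parts a (c *: a + s + u) = (c, s, u).
Proof.
move=> pa seta uhalf; have [setaE uhalfE xE] := partsP (c *: a + s + u) pa.
have [[_ dec _] a_neq0 eig1] := pa.
have aa k : eigen mul a 1 (k *: a).
  by rewrite /eigen /= mulZr prim_idem// scale1r.
have [d [_ dU]] := dec (c *: a + s + u).
have E1 : d = (c *: a, s, u) by apply: dU; split => //; apply: aa.
move: (xE); set x := c *: a + s + u => xE'.
have : d = (axial_coef a x *: a, eta_part a x, half_part a x).
  by apply: dU; split => //; apply: aa.
rewrite {}E1 => -[/eqP + sE uE].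
rewrite -subr_eq0 -scalerBl scaler_eq0 (negPf a_neq0) orbF subr_eq0 => /eqP cE.
by rewrite cE sE uE /axial_coef /eta_part /half_part; case: (parts a x) => -[].
Qed.

Lemma parts_linear a k x y : prim a ->
  parts a (k *: x + y) =
  (k * axial_coef a x + axial_coef a y, k *: eta_part a x + eta_part a y,
   k *: half_part a x + half_part a y).
Proof.
move=> pa; have [xs xu xE] := partsP x pa; have [ys yu yE] := partsP y pa.
rewrite [in LHS]xE [in LHS]yE.
rewrite -[RHS](@parts_unique a) //; first last.
- by rewrite mulDr mulZr xu yu scalerDr !scalerA mulrC.
- by rewrite mulDr mulZr xs ys scalerDr !scalerA mulrC.
congr (parts a _); rewrite !scalerDr scalerA scalerDl addrACA.
by congr (_ + _); rewrite addrACA.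
Qed.

Lemma axial_coef_linear a : prim a ->
  forall k x y, axial_coef a (k *: x + y) = k * axial_coef a x + axial_coef a y.
Proof. by move=> pa k x y; rewrite {1}/axial_coef parts_linear. Qed.

Lemma half_part_linear a : prim a ->
  forall k x y, half_part a (k *: x + y) = k *: half_part a x + half_part a y.
Proof. by move=> pa k x y; rewrite {1}/half_part parts_linear. Qed.

Section Axis.

Variables (a : A) (pa : prim a).

Lemma axial_coefD x y : axial_coef a (x + y) = axial_coef a x + axial_coef a y.
Proof. by have := axial_coef_linear pa 1 x y; rewrite scale1r mul1r. Qed.

Lemma half_partD x y : half_part a (x + y) = half_part a x + half_part a y.
Proof. by have := half_part_linear pa 1 x y; rewrite !scale1r. Qed.

Lemma axial_coef0 : axial_coef a 0 = 0.
Proof. by apply: (@addIr _ (axial_coef a 0)); rewrite -axial_coefD !add0r. Qed.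

Lemma half_part0 : half_part a 0 = 0.
Proof. by apply: (@addIr _ (half_part a 0)); rewrite -half_partD !add0r. Qed.

Lemma axial_coefZ k x : axial_coef a (k *: x) = k * axial_coef a x.
Proof. by have := axial_coef_linear pa k x 0; rewrite axial_coef0 !addr0. Qed.

Lemma half_partZ k x : half_part a (k *: x) = k *: half_part a x.
Proof. by have := half_part_linear pa k x 0; rewrite half_part0 !addr0. Qed.

Lemma half_partB x y : half_part a (x - y) = half_part a x - half_part a y.
Proof. by rewrite -scaleN1r half_partD half_partZ scaleN1r. Qed.

Lemma half_part_id u : mul a u = 2^-1 *: u -> half_part a u = u.
Proof.
move=> uE; have := @parts_unique a 0 0 u pa.
by rewrite scale0r !add0r linear0r scaler0 /half_part => ->.
Qed.

Lemma axial_coef_half u : mul a u = 2^-1 *: u -> axial_coef a u = 0.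
Proof.
move=> uE; have := @parts_unique a 0 0 u pa.
by rewrite scale0r !add0r linear0r scaler0 /axial_coef => ->.
Qed.

Lemma axial_coef_eta s : mul a s = eta *: s -> axial_coef a s = 0.
Proof.
move=> sE; have := @parts_unique a 0 s 0 pa.
by rewrite scale0r !add0r addr0 linear0r scaler0 /axial_coef => ->.
Qed.

Lemma axial_coef_axis : axial_coef a a = 1.
Proof.
have := @parts_unique a 1 0 0 pa.
by rewrite scale1r !addr0 linear0r !scaler0 /axial_coef => ->.
Qed.

Lemma half_part_even c s : mul a s = eta *: s -> half_part a (c *: a + s) = 0.
Proof.
move=> sE; have := @parts_unique a c s 0 pa.
by rewrite addr0 linear0r scaler0 /half_part => ->.
Qed.

Lemma half_part_axis : half_part a a = 0.
Proof.
have := @half_part_even 1 0; rewrite scale1r addr0 linear0r scaler0; exact.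
Qed.

Lemma half_part_eta s : mul a s = eta *: s -> half_part a s = 0.
Proof. by move=> /(half_part_even 0); rewrite scale0r add0r. Qed.

Lemma half_partK x : half_part a (half_part a x) = half_part a x.
Proof. by apply: half_part_id; case: (partsP x pa). Qed.

Lemma mul_half x : half_part a x = x -> mul a x = 2^-1 *: x.
Proof. by move=> <-; case: (partsP x pa). Qed.

Lemma evenE x : half_part a x = 0 -> x = axial_coef a x *: a + eta_part a x.
Proof. by move=> hx; have [_ _] := partsP x pa; rewrite hx addr0. Qed.

Lemma mul_etaP x : mul a (eta_part a x) = eta *: eta_part a x.
Proof. by case: (partsP x pa). Qed.

(** * The grading modulo 2 and multiplication by an axis *)

(** The fusion law is graded modulo 2: the 1- and eta-eigenspaces form the even part, encoded as
    [half_part a x = 0], and the 1/2-eigenspace is the odd part, encoded as [half_part a x = x]. *)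
Lemma even_mul_even x y :
  half_part a x = 0 -> half_part a y = 0 -> half_part a (mul x y) = 0.
Proof.
move=> /evenE -> /evenE ->.
have [[_ _ fus] _ eig1] := pa.
have [k _ kE] : [set c *: a | c in [set: F]]%classic
    (mul (eta_part a x) (eta_part a y)).
  rewrite -eig1; apply: (fusion_eta_eta fus).
  by exists (eta_part a x); [exact: mul_etaP|exists (eta_part a y); [exact: mul_etaP|]].
rewrite mulDl !mulDr -kE !mulZl !mulZr mul_etaP (mulC (eta_part a x)) mul_etaP.
rewrite (prim_idem pa) !half_partD !half_partZ half_part_axis.
by rewrite !(half_part_eta (mul_etaP _)) !scaler0 !addr0.
Qed.

Lemma even_mul_odd x y :
  half_part a x = 0 -> half_part a y = y -> half_part a (mul x y) = mul x y.
Proof.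
move=> /evenE -> /mul_half ay; have [[_ _ fus] _ _] := pa.
apply: half_part_id; rewrite mulDl mulDr scalerDr; congr (_ + _).
  by rewrite mulZl ay !mulZr ay !scalerA mulrC mulrA.
apply: (fusion_eta_half fus).
by exists (eta_part a x); [exact: mul_etaP|exists y].
Qed.

Lemma odd_mul_odd x y :
  half_part a x = x -> half_part a y = y -> half_part a (mul x y) = 0.
Proof.
move=> /mul_half ax /mul_half ay; have [[_ _ fus] _ eig1] := pa.
have [v v1 [s sE <-]] : set_sum (eigen mul a 1) (eigen mul a eta) (mul x y).
  by apply: (fusion_half_half fus); exists x => //; exists y.
have [c _ <-] : [set c *: a | c in [set: F]]%classic v by rewrite -eig1.
exact: half_part_even.
Qed.

Lemma half_part_sub x : half_part a (x - half_part a x) = 0.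
Proof. by rewrite half_partB half_partK subrr. Qed.

Lemma half_part_mul_axis x : half_part a (mul a x) = 2^-1 *: half_part a x.
Proof.
rewrite -{1}[x](subrK (half_part a x)) mulDr half_partD.
rewrite even_mul_even ?half_part_axis ?half_part_sub // add0r.
by rewrite mul_half ?half_partK // half_partZ half_partK.
Qed.

Lemma mul_axis_even x : half_part a x = 0 ->
  mul a x = (axial_coef a x * (1 - eta)) *: a + eta *: x.
Proof.
move=> hx; move: (evenE hx) (mul_etaP x).
move: (axial_coef a x) (eta_part a x) => c s -> sE.
rewrite mulDr mulZr prim_idem // sE scalerDr scalerA addrA -scalerDl.
by congr (_ *: _ + _); ring.
Qed.

(** The operator (L - eta)(L - 1/2), with L multiplication by [a], kills the eta- and 1/2-components
    and scales [a] by (1 - eta)/2. Stated without the components of [x] other than its coefficient,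
    the relation can be projected along a second axis. *)
Lemma mul_axis_mul_axis x :
  mul a (mul a x) = (eta + 2^-1) *: mul a x
    + ((2^-1 * axial_coef a x * (1 - eta)) *: a - (2^-1 * eta) *: x).
Proof.
have [es uh xE] := partsP x pa; move: xE es uh.
set c := axial_coef a x; set s := eta_part a x; set u := half_part a x.
move=> xE es uh; have {}xE : x = c *: a + 1 *: s + 1 *: u by rewrite !scale1r.
have axE : mul a x = c *: a + eta *: s + 2^-1 *: u.
  by rewrite xE !mulDr !mulZr es uh prim_idem // !scale1r.
have -> : mul a (mul a x) =
    c *: a + (eta * eta) *: s + (2^-1 * 2^-1) *: u.
  by rewrite axE !mulDr !mulZr es uh prim_idem // !scalerA.
rewrite axE xE -scaleNr !lin3Z.
have aE k : k *: a = k *: a + 0 *: s + 0 *: u by rewrite !scale0r !addr0.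
rewrite [(_ * (1 - eta)) *: a]aE !lin3D.
(* The coefficients of [a], [s] and [u] agree separately; the one of [a] relies on 1/2 + 1/2 = 1. *)
have two0 := two_neq0.
congr (_ *: _ + _ *: _ + _ *: _); first by field.
  by ring.
by ring.
Qed.

(** * The Miyamoto involution of an axis *)

Definition miyamoto x := x - 2 *: half_part a x.

Lemma miyamotoE x y : half_part a x = 0 -> half_part a y = y ->
  miyamoto (x + y) = x - y.
Proof.
by move=> hx hy; rewrite /miyamoto half_partD hx add0r hy scaler_nat mulr2n
  opprD addrA addrK.
Qed.

Lemma miyamoto_linear k x y : miyamoto (k *: x + y) = k *: miyamoto x + miyamoto y.
Proof.
rewrite /miyamoto half_part_linear // scalerDr scalerBr !scalerA (mulrC 2).
by rewrite opprD addrACA.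
Qed.

Lemma miyamotoK : involutive miyamoto.
Proof.
move=> x; have [ex ux] := (half_part_sub x, half_partK x).
rewrite -{1}[x](subrK (half_part a x)) (miyamotoE ex ux) miyamotoE //.
  by rewrite opprK subrK.
by rewrite -scaleN1r half_partZ ux.
Qed.

(** The map is +1 on the even part and -1 on the odd part, so multiplicativity is exactly the
    grading modulo 2. *)
Lemma miyamotoM x y : miyamoto (mul x y) = mul (miyamoto x) (miyamoto y).
Proof.
have [ex ey] := (half_part_sub x, half_part_sub y).
have [ux uy] := (half_partK x, half_partK y).
rewrite -[x](subrK (half_part a x)) -[y](subrK (half_part a y)).
move: ex ey ux uy; move: (half_part a x) (x - half_part a x).
move: (half_part a y) (y - half_part a y) => {x y} u' e' u e he he' hu hu'.
rewrite !miyamotoE //.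
have -> : mul (e + u) (e' + u') =
    (mul e e' + mul u u') + (mul e u' + mul u e').
  by rewrite mulDl !mulDr [RHS]addrACA [mul u u' + _]addrC.
rewrite miyamotoE; first by rewrite mulDl !mulDr !mulNl !mulNr opprK opprD
   [- _ + mul u u']addrC [RHS]addrACA.
  by rewrite half_partD even_mul_even ?odd_mul_odd ?addr0.
by rewrite [mul u e']mulC half_partD !even_mul_odd.
Qed.

Lemma miyamoto_even x : half_part a x = 0 -> miyamoto x = x.
Proof. by move=> hx; rewrite /miyamoto hx scaler0 subr0. Qed.

End Axis.

(** * Symmetry of the axial coefficients *)

(* Compare the 1/2-components with respect to [a] of both sides of the quadratic
   relation [mul_axis_mul_axis] for [b (b a)].  If the 1/2-component of [b] is not
   zero, its coefficients give the equality because [eta != 1].  If [a] and [b]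
   both have zero 1/2-component with respect to the other, compare the two expressions of [mul a b]
   as combinations of [a] and [b]. *)
Lemma axial_coef_sym a b : prim a -> prim b ->
  axial_coef a b = axial_coef b a.
Proof.
suff half_neq0 a1 b1 : prim a1 -> prim b1 -> half_part a1 b1 != 0 ->
    axial_coef a1 b1 = axial_coef b1 a1.
  move=> pa pb; have [hab|] := eqVneq (half_part a b) 0; last exact: half_neq0.
  have [hba|] := eqVneq (half_part b a) 0; last by move/half_neq0->.
  have [_ _ eig1] := pa; have [_ b_neq0 _] := pb.
  set p := axial_coef a b; set q := axial_coef b a.
  have : (p * (1 - eta) - eta) *: a = (q * (1 - eta) - eta) *: b.
    rewrite !scalerBl; apply/eqP; rewrite subr_eq addrAC eq_sym subr_eq eq_sym.
    by rewrite -mul_axis_even // mulC mul_axis_even.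
  have [Yq0|q0] := eqVneq (q * (1 - eta) - eta) 0.
    rewrite Yq0 scale0r => /eqP; rewrite scaler_eq0; have [_ /negPf-> _] := pa.
    rewrite orbF -Yq0 => /eqP/addIr/mulIf; apply.
    by rewrite subr_eq0 eq_sym.
  (* Here [b] is a nonzero multiple [k *: a]; as both are idempotent, k^2 = k, hence k = 1 and [b]
     equals [a]. *)
  move=> /(congr1 ( *:%R (q * (1 - eta) - eta)^-1)).
  rewrite !scalerA mulVf // scale1r; set k := _ * _ => bE.
  have k_neq0 : k != 0 by apply: contraNneq b_neq0 => k0; rewrite -bE k0 scale0r.
  have := prim_idem pb; rewrite -bE mulZl mulZr prim_idem // scalerA => /eqP.
  rewrite -subr_eq0 -scalerBl scaler_eq0; have [_ /negPf-> _] := pa.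
  rewrite orbF -{3}[k]mulr1 -mulrBr mulf_eq0 (negPf k_neq0) subr_eq0 => /eqP k1.
  by move: bE; rewrite k1 scale1r /p /q => ->.
move=> {a b} pa pb; set p := axial_coef a1 b1; set q := axial_coef b1 a1 => u_neq0.
set u := half_part a1 b1 in u_neq0; set e := b1 - u.
have hu : half_part a1 u = u by exact: half_partK.
have he : half_part a1 e = 0 by exact: half_part_sub.
have au : mul a1 u = 2^-1 *: u by exact: mul_half.
have pE : axial_coef a1 e = p.
  by rewrite axial_coefD // -scaleN1r axial_coefZ // (axial_coef_half pa au) mulr0 addr0.
have ae : mul a1 e = (p * (1 - eta)) *: a1 + eta *: e by rewrite mul_axis_even // pE.
have bE : b1 = e + u by rewrite subrK.
have half_mul x y : half_part a1 x = 0 -> half_part a1 y = y ->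
    half_part a1 (mul b1 (x + y)) = mul e y + mul u x.
  move=> hx hy; rewrite bE mulDl !mulDr !half_partD // even_mul_even // add0r.
  by rewrite (even_mul_odd pa he hy) (mulC u x) even_mul_odd // odd_mul_odd // addr0.
have eu : mul e u = 2^-1 *: u.
  rewrite -[LHS]scale2_half -scalerDr; congr (_ *: _).
  by rewrite {2}[mul e u]mulC -half_mul // -bE prim_idem.
(* The product of [a1] and [b1] has even part p(1 - eta) a1 + eta e and odd part u/2; the odd part
   of its product with e + u uses only [au] and [eu]. *)
have bab : half_part a1 (mul b1 (mul b1 a1)) =
    (2^-1 * 2^-1 + 2^-1 * (p * (1 - eta)) + 2^-1 * eta) *: u.
  rewrite {2}bE [mul _ a1]mulC mulDr half_mul; first last.
  - by rewrite au half_partZ // hu.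
  - by rewrite even_mul_even // half_part_axis.
  rewrite au ae mulZr mulDr !mulZr [mul u a1]mulC au [mul u e]mulC eu.
  by rewrite !scalerA -!scalerDl; congr (_ *: _); ring.
(* The quadratic relation for [b1] gives the coefficient (eta + 1/2)/2 + q(1 - eta)/2 of [u];
   subtracting the one in [bab] leaves (1 - eta)(q - p)/2. *)
have := bab; rewrite mul_axis_mul_axis // half_partD // half_partB // !half_partZ //.
rewrite half_part_axis // scaler0 subr0 [mul b1 a1]mulC half_part_mul_axis //.
rewrite -/u -/q scalerA -scalerDl => /eqP.
rewrite -subr_eq0 -scalerBl scaler_eq0 (negPf u_neq0) orbF => /eqP E0.
have /eqP : 2^-1 * (1 - eta) * (q - p) = 0 by rewrite -E0; ring.
rewrite !mulf_eq0 invr_eq0 (negPf two_neq0) !subr_eq0 eq_sym (negPf eta_neq1) /=.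
by move/eqP.
Qed.


(** * Transport of axes along involutive automorphisms *)

Section Automorphism.

Variable t : A -> A.
Hypothesis (t_linear : linear t) (tK : involutive t).
Hypothesis tM : {morph t : x y / mul x y}.

Lemma autoD x y : t (x + y) = t x + t y.
Proof. by have := t_linear 1 x y; rewrite !scale1r. Qed.

Lemma auto0 : t 0 = 0.
Proof. by apply: (@addIr _ (t 0)); rewrite -autoD !add0r. Qed.

Lemma autoZ k x : t (k *: x) = k *: t x.
Proof. by have := t_linear k x 0; rewrite auto0 !addr0. Qed.

Lemma eigen_auto b l x : eigen mul b l (t x) = eigen mul (t b) l x.
Proof.
rewrite /eigen /=; apply/propext; split=> [|E].
  by move=> /(congr1 t); rewrite tM autoZ tK.
by rewrite -{1}[b]tK -tM E autoZ.
Qed.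

(** The targets [S] and [S'] are left general so that all six fusion rules are covered, including
    the one whose target is a sum of eigenspaces. *)
Lemma auto_fusion b l m (S S' : set A) :
  (set_mul mul (eigen mul b l) (eigen mul b m) `<=` S)%classic ->
  (forall x, S x -> S' (t x)) ->
  (set_mul mul (eigen mul (t b) l) (eigen mul (t b) m) `<=` S')%classic.
Proof.
move=> sub SS' _ [x + [y + <-]]; rewrite -!eigen_auto => xl ym.
rewrite -[mul x y]tK; apply: SS'; apply: sub.
by rewrite tM; exists (t x) => //; exists (t y).
Qed.

Lemma auto_prim b : prim b -> prim (t b).
Proof.
have eig l x : eigen mul b l x -> eigen mul (t b) l (t x).
  by rewrite -eigen_auto tK.
move=> [[bb dec [f11 f1e f1h fee feh fhh]] b_neq0 eig1]; split.
- split; first by rewrite -tM bb.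
    move=> x; have [[[v s] u] [[/= v1 se uh xE] dU]] := dec (t x).
    exists (t v, t s, t u); split=> /=.
      split; [exact: eig|exact: eig|exact: eig|].
      by rewrite -!autoD -xE tK.
    move=> [[v' s'] u'] [/=]; rewrite -!eigen_auto => v1' se' uh' xE'.
    have [-> -> ->] : (v, s, u) = (t v', t s', t u').
      by apply: dU; split=> //=; rewrite -!autoD -xE'.
    by rewrite !tK.
  split.
  + exact: (auto_fusion f11 (eig _)).
  + exact: (auto_fusion f1e (eig _)).
  + exact: (auto_fusion f1h (eig _)).
  + exact: (auto_fusion fee (eig _)).
  + exact: (auto_fusion feh (eig _)).
  + apply: (auto_fusion fhh) => _ [v v1 [s se <-]].
    exists (t v); first exact: eig.
    by exists (t s); [exact: eig|rewrite autoD].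
- by apply: contraNneq b_neq0 => tb0; rewrite -[b]tK tb0 auto0.
- apply/seteqP; split=> x /=.
    rewrite -eigen_auto eig1 => -[c _ /(congr1 t)]; rewrite tK autoZ => <-.
    by exists c.
  by move=> [c _ <-]; rewrite -autoZ; apply: eig; rewrite eig1; exists c.
Qed.

Lemma axial_coef_auto b x : prim b -> axial_coef (t b) (t x) = axial_coef b x.
Proof.
move=> pb; have [es uh xE] := partsP x pb.
rewrite [in LHS]xE !autoD autoZ {1}/axial_coef parts_unique //.
- exact: auto_prim.
- by rewrite -tM es autoZ.
- by rewrite -tM uh autoZ.
Qed.

End Automorphism.

(** * The primitive axes span the algebra *)

(** All primitive axes are allowed, not just the generating ones, since Miyamoto images may leave
    the generating set. The inductive form reduces statements linear in a vector to the case of an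
    axis. *)
Inductive axes_span : A -> Prop :=
| axes_span0 : axes_span 0
| axes_spanD x y : axes_span x -> axes_span y -> axes_span (x + y)
| axes_spanZ k x : axes_span x -> axes_span (k *: x)
| axes_span_axis a : prim a -> axes_span a.

(* If [c] is the image of [b] under the Miyamoto involution of [a], then [b + c]
   and [b - c] isolate the component of [b] outside and inside
   the 1/2-eigenspace, so [mul a b] is a
   combination of [a], [b] and [c]. *)
Lemma mul_axes_span a b : prim a -> prim b -> axes_span (mul a b).
Proof.
move=> pa pb.
have sc : axes_span (miyamoto a b).
  apply: axes_span_axis; apply: auto_prim pb; [exact: miyamoto_linear|exact: miyamotoK|].
  by move=> x y; apply: miyamotoM.
have su : axes_span (half_part a b).
  have -> : half_part a b = 2^-1 *: (b + (-1) *: miyamoto a b).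
    by rewrite scaleN1r /miyamoto opprB addrC subrK scalerA mulVf ?two_neq0 ?scale1r.
  by apply/axes_spanZ/axes_spanD/axes_spanZ => //; apply: axes_span_axis.
rewrite -[b](subrK (half_part a b)) mulDr mul_axis_even ?half_part_sub //.
rewrite mul_half ?half_partK // -scaleN1r.
have sa := axes_span_axis pa; have sb := axes_span_axis pb.
by do 3 ?[apply: axes_spanD | apply: axes_spanZ] => //; apply: axes_spanD => //;
  apply: axes_spanZ.
Qed.

Lemma axes_spanM x y : axes_span x -> axes_span y -> axes_span (mul x y).
Proof.
move=> + sy; elim=> [|x1 x2 _ IH1 _ IH2|k x1 _ IH|a pa].
- by rewrite linear0l; exact: axes_span0.
- by rewrite mulDl; exact: axes_spanD.
- by rewrite mulZl; exact: axes_spanZ.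
elim: sy => [|x1 x2 _ IH1 _ IH2|k x1 _ IH|b pb]; last exact: mul_axes_span.
- by rewrite linear0r; exact: axes_span0.
- by rewrite mulDr; exact: axes_spanD.
- by rewrite mulZr; exact: axes_spanZ.
Qed.

Lemma axes_spanT (X : set A) : (X `<=` prim)%classic -> generates mul X ->
  forall x, axes_span x.
Proof.
move=> Xprim Xgen x.
suff : (smallest (is_subalgebra mul) X `<=` axes_span)%classic.
  by apply; rewrite Xgen.
apply: smallest_sub; last by move=> a /Xprim; exact: axes_span_axis.
split; [exact: axes_span0|exact: axes_spanD|exact: axes_spanZ|exact: axes_spanM].
Qed.

(** * Construction of the form *)

Section Form.

Hypothesis spanT : forall x, axes_span x.

Definition axes_combination x : seq (F * A) :=
  xget [::] [set r : seq (F * A) | (forall p, p \in r -> prim p.2) /\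
    x = \sum_(p <- r) p.1 *: p.2]%classic.

Lemma axes_combinationP x :
  (forall p, p \in axes_combination x -> prim p.2) /\
  x = \sum_(p <- axes_combination x) p.1 *: p.2.
Proof.
apply: (@xgetPex _ [::] [set r : seq (F * A) | (forall p, p \in r -> prim p.2) /\
    x = \sum_(p <- r) p.1 *: p.2]%classic).
elim: (spanT x) => [|_ _ _ [r [rp ->]] _ [r' [rp' ->]]|k _ _ [r [rp ->]]|a pa].
- by exists [::]; split; rewrite ?big_nil.
- exists (r ++ r'); split; last by rewrite big_cat.
  by move=> p; rewrite mem_cat => /orP[/rp|/rp'].
- exists [seq (k * p.1, p.2) | p <- r]; split=> [_ /mapP[p /rp pp ->]//|].
  by rewrite big_map scaler_sumr; apply: eq_bigr => p _; rewrite scalerA.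
exists [:: (1, a)]; split; last by rewrite big_seq1 scale1r.
by move=> p; rewrite inE => /eqP->.
Qed.

(** Linearity in [y] is immediate, but the dependence on [x] goes through a chosen combination;
    linearity in [x] will come from the symmetry of the form. *)
Definition axial_form x y :=
  \sum_(p <- axes_combination x) p.1 * axial_coef p.2 y.

Lemma axial_form_linear x : linear_for *%R (axial_form x).
Proof.
move=> k y z; rewrite /axial_form mulr_sumr -big_split /=.
have [rp _] := axes_combinationP x.
apply: eq_big_seq => p /rp pp; rewrite axial_coef_linear // mulrDr; congr (_ + _).
ring.
Qed.

Lemma axial_formDr x y z : axial_form x (y + z) = axial_form x y + axial_form x z.
Proof. by have := axial_form_linear x 1 y z; rewrite scale1r mul1r. Qed.

Lemma axial_form0r x : axial_form x 0 = 0.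
Proof. by apply: (@addIr _ (axial_form x 0)); rewrite -axial_formDr !add0r. Qed.

Lemma axial_formZr k x y : axial_form x (k *: y) = k * axial_form x y.
Proof. by have := axial_form_linear x k y 0; rewrite axial_form0r !addr0. Qed.

(** By [axial_coef_sym], each term of the sum becomes the coefficient along [b] of a summand of [x].
    The result no longer involves the chosen combination. *)
Lemma axial_form_axis x b : prim b -> axial_form x b = axial_coef b x.
Proof.
move=> pb; have [rp xE] := axes_combinationP x.
rewrite [in RHS]xE (big_morph _ (axial_coefD pb) (axial_coef0 pb)).
by apply: eq_big_seq => p /rp pp; rewrite axial_coefZ // (axial_coef_sym pp pb).
Qed.

Lemma axial_formC x y : axial_form x y = axial_form y x.
Proof.
have [rp yE] := axes_combinationP y.
rewrite [in LHS]yE (big_morph _ (axial_formDr x) (axial_form0r x)).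
by apply: eq_big_seq => p /rp pp; rewrite axial_formZr axial_form_axis.
Qed.

Lemma axial_form_axisl a y : prim a -> axial_form a y = axial_coef a y.
Proof. by move=> pa; rewrite axial_formC axial_form_axis. Qed.

Lemma axial_formDl x y z : axial_form (x + y) z = axial_form x z + axial_form y z.
Proof. by rewrite axial_formC axial_formDr !(axial_formC z). Qed.

Lemma axial_formZl k x y : axial_form (k *: x) y = k * axial_form x y.
Proof. by rewrite axial_formC axial_formZr axial_formC. Qed.

(** By linearity [x] may be taken to be an axis [b]; its image is again a primitive axis, and the
    involution carries the decomposition along [b] to the one along that image. *)
Lemma axial_form_miyamoto a x y : prim a ->
  axial_form (miyamoto a x) (miyamoto a y) = axial_form x y.
Proof.
move=> pa; have tl := miyamoto_linear pa; have tK := miyamotoK pa.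
have tM := miyamotoM pa.
elim: (spanT x) => [|x1 x2 _ IH1 _ IH2|k x1 _ IH|b pb].
- by rewrite (auto0 tl) -(scale0r 0) !axial_formZl !mul0r.
- by rewrite (autoD tl) [LHS]axial_formDl IH1 IH2 -axial_formDl.
- by rewrite (autoZ tl) !axial_formZl IH.
by rewrite !axial_form_axisl // ?(axial_coef_auto tl tK tM) //; exact: auto_prim.
Qed.

(** The involution fixes [x] and negates [y], so invariance makes the value equal to its own
    negative, and 2 is invertible. *)
Lemma axial_form_even_odd a x y : prim a ->
  half_part a x = 0 -> half_part a y = y -> axial_form x y = 0.
Proof.
move=> pa hx hy; apply/eqP; have := axial_form_miyamoto x y pa.
rewrite miyamoto_even // -[y in miyamoto a y]add0r miyamotoE ?half_part0 //.
rewrite add0r -scaleN1r axial_formZr mulN1r => /eqP.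
by rewrite eq_sym -subr_eq0 opprK -mulr2n -mulr_natl mulf_eq0 (negPf two_neq0).
Qed.

(** Distinct eigenspaces of [a] are orthogonal: even against odd by the previous lemma, [a] against
    an eta-eigenvector because the axial coefficient vanishes. On each eigenspace [a] acts by a
    scalar, which moves freely across the form. *)
Lemma axial_form_mul_axis a x z : prim a ->
  axial_form (mul a x) z = axial_form x (mul a z).
Proof.
move=> pa; have [xs xu xE] := partsP x pa; have [zs zu zE] := partsP z pa.
have eo s u : mul a s = eta *: s -> mul a u = 2^-1 *: u ->
    axial_form s u = 0 /\ axial_form u s = 0.
  move=> se uh; rewrite (axial_formC u); split; apply: (axial_form_even_odd pa);
    by [exact: half_part_eta|exact: half_part_id].
have [su _] := eo _ _ xs zu; have [_ us] := eo _ _ zs xu.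
rewrite xE zE !mulDr !mulZr xs xu zs zu prim_idem //.
rewrite !axial_formDl !axial_formDr !axial_formZl !axial_formZr su us.
rewrite !(axial_form_axisl _ pa) !(axial_form_axis _ pa).
rewrite (axial_coef_eta pa xs) (axial_coef_eta pa zs).
rewrite (axial_coef_half pa xu) (axial_coef_half pa zu).
ring.
Qed.

Lemma axial_formA x y z : axial_form (mul x y) z = axial_form x (mul y z).
Proof.
elim: (spanT y) => [|y1 y2 _ IH1 _ IH2|k y1 _ IH|a pa].
- by rewrite linear0l linear0r -(scale0r 0) axial_formZl axial_formZr !mul0r.
- by rewrite mulDr mulDl axial_formDl axial_formDr IH1 IH2.
- by rewrite mulZr mulZl axial_formZl axial_formZr IH.
by rewrite mulC axial_form_mul_axis.
Qed.

End Form.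

(** * Uniqueness of the form *)

(** If [y] has eigenvalue l different from 1, associativity on (aa, y) gives g a y = l g a y, hence
    0; only the [a]-component of [x] contributes. *)
Lemma normalized_form_axis (g : {biscalar A}) a x :
  normalized_Frobenius_form mul eta g -> prim a -> g a x = axial_coef a x.
Proof.
move=> [[_ _ gA] g1] pa; have [es uh xE] := partsP x pa.
have orth l y : l != 1 -> mul a y = l *: y -> g a y = 0.
  move=> l1 ay; apply/eqP; have := gA a a y.
  rewrite prim_idem // ay linearZr_LR => /eqP.
  by rewrite -subr_eq0 -{1}[g a y]mul1r -mulrBl mulf_eq0 subr_eq0 eq_sym (negPf l1).
have half1 : 2^-1 != 1 :> F.
  rewrite -(inj_eq invr_inj) invrK invr1 -subr_eq0 -[2]/(1 + 1) addrK.
  exact: oner_neq0.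
rewrite {1}xE !linearDr linearZr_LR g1 // (orth _ _ eta_neq1 es) (orth _ _ half1 uh).
by rewrite !addr0 mulr1.
Qed.

End PrimitiveAxes.

Theorem proposition4 (F : fieldType) (charF : 2%N \notin [pchar F])
    (eta : F) (eta_neq1 : eta != 1) (eta_neq_half : eta != 2^-1)
    (A : lmodType F) (mul : {bilinear A -> A -> A})
    (primA : primitive_PC_axial mul eta) :
  exists f : {biscalar A},
    normalized_Frobenius_form mul eta f /\
    forall g : {biscalar A}, normalized_Frobenius_form mul eta g -> g =2 f.
Proof.
have [mulC [X [[a0 Xa0] Xprim Xgen]]] := primA.
have spanT := axes_spanT charF mulC Xprim Xgen.
have fD := axial_formDl charF eta_neq1 mulC spanT.
have fZ := axial_formZl charF eta_neq1 mulC spanT.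
have f_bilinear : bilinear_for (GRing.mul : GRing.Scale.law F F)
    (GRing.mul : GRing.Scale.law F F) (axial_form eta mul).
  split=> [y k x x' /=|x]; first by rewrite fD fZ.
  exact: axial_form_linear.
pose f : {biscalar A} :=
  HB.pack (axial_form eta mul) (bilinear_isBilinear.Build _ _ _ _ _ _ _ f_bilinear).
have f_axis a x : is_primitive_axis mul eta a -> f a x = axial_coef eta mul a x.
  exact: axial_form_axisl.
exists f; split.
  split; last by move=> a pa; rewrite f_axis // axial_coef_axis.
  split; [|exact: axial_formC|exact: axial_formA].
  (* A generating axis pairs with itself to 1, so the form is nonzero. *)
  by exists a0, a0; rewrite f_axis ?axial_coef_axis ?oner_neq0 //; exact: Xprim.
move=> g gN x y; elim: (spanT x) => [|x1 x2 _ IH1 _ IH2|k x1 _ IH|a pa].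
- by rewrite !linear0l.
- by rewrite !linearDl IH1 IH2.
- by rewrite !linearZl_LR IH.
by rewrite f_axis // (normalized_form_axis eta_neq1 _ gN).
Qed.
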